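(* Every graph $G$ satisfies $\text{pp}(G) \leq \text{indpp}(G) \leq \text{ipp}(G) \leq |V(G)|-\nu(G)$.
   Context: All graphs are finite, simple, and nonnull (at least one vertex). A path (resp. induced path) in $G$ is a subgraph (resp. induced subgraph) of $G$ that is a path, possibly with only one vertex. An isometric path in $G$ is a path in $G$ that is of smallest possible length (number of edges) among all paths in $G$ between its two endpoints (one-vertex paths are isometric). A path partition (resp. induced path partition, isometric path partition) of $G$ is a collection of paths (resp. induced paths, isometric paths) in $G$ whose vertex sets partition $V(G)$; the smallest cardinality of such a collection is denoted by $\text{pp}(G)$ (resp. $\text{indpp}(G)$, $\text{ipp}(G)$). The matching number $\nu(G)$ is the largest cardinality of a matching of $G$. *)

(* Defs.v *)
From mathcomp Require Import all_boot.

Set Implicit Arguments.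
Unset Strict Implicit.
Unset Printing Implicit Defensive.

Record sgraph := SGraph {
  vertex :> finType;
  adj : rel vertex;
  adj_sym : symmetric adj;
  adj_irr : irreflexive adj;
  vertex_nonnull : 0 < #|vertex|
}.

Definition edges (G : sgraph) : {set {set G}} :=
  [set [set z.1; z.2] | z : G * G & adj z.1 z.2].

(* A vertex set together with a set of edges, each edge being the set of its
   two ends; [is_subgraph] says that such a pair is a subgraph of G. *)
Notation preSubgraph G := ({set vertex G} * {set {set vertex G}})%type.

Section Subgraphs.
Variable G : sgraph.
Implicit Types (x y : G) (p : seq G) (H : preSubgraph G).

Definition is_subgraph H :=
  (H.2 \subset edges G) && [forall e in H.2, e \subset H.1].

Definition is_induced_subgraph H :=
  H.2 == [set e in edges G | e \subset H.1].

(* The path visiting x, p_0, p_1, ... in this order: [zip (x :: p) p] lists the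
   pairs of consecutive vertices. *)
Definition path_graph x p : preSubgraph G :=
  ([set z in x :: p], [set [set z.1; z.2] | z in zip (x :: p) p]).

(* A path of length n has n + 1 distinct vertices, whence the bound n < #|G|. *)
Definition is_path_between x y H :=
  is_subgraph H &&
  [exists n : 'I_#|G|, exists p : n.-tuple G,
     [&& uniq (x :: p), last x p == y & H == path_graph x p]].

Definition is_path H := [exists x, exists y, is_path_between x y H].

Definition is_induced_path H := is_induced_subgraph H && is_path H.

Definition path_length H := #|H.2|.

Definition is_isometric_path H :=
  [exists x, exists y, is_path_between x y H &&
     [forall H' : preSubgraph G,
        is_path_between x y H' ==> (path_length H <= path_length H')]].

(* [partition] applies to the set of the vertex sets, and so would not by itself
   exclude two members of P with the same vertex set. *)
Definition vertex_partition (P : {set preSubgraph G}) :=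
  dinjectiveb fst P && partition [set H.1 | H in P] [set: G].

Definition partitionable_into (Q : pred (preSubgraph G)) (k : nat) :=
  [exists P : {set preSubgraph G},
     [&& vertex_partition P, [forall H in P, Q H] & #|P| == k]].

Lemma singleton_partition (Q : pred (preSubgraph G)) :
  (forall x, Q (path_graph x [::])) -> exists k, partitionable_into Q k.
Proof.
move=> Qx; pose P := [set path_graph x [::] | x : G].
have E x : (path_graph x [::]).1 = [set x].
  by apply/setP => z; rewrite !inE.
exists #|P|; apply/existsP; exists P; apply/and3P; split => //; last first.
  by apply/forall_inP => _ /imsetP[x _ ->].
apply/andP; split.
  apply/dinjectiveP => H H' /imsetP[x _ ->{H}] /imsetP[y _ ->{H'}].
  by rewrite !E => /set1_inj ->.
apply/and3P; split.
- apply/eqP/setP => x; rewrite inE; apply/bigcupP; exists [set x]; last first.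
    by rewrite inE.
  by rewrite -E imset_f // imset_f.
- apply/trivIsetP => A B /imsetP[H /imsetP[x _ ->{H}] ->{A}].
  move=> /imsetP[H /imsetP[y _ ->{H}] ->{B}]; rewrite !E => xy.
  by rewrite disjoints1 inE; apply: contraNN xy => /eqP->.
- apply/negP => /imsetP[_ /imsetP[x _ ->]]; rewrite E => /setP/(_ x).
  by rewrite !inE eqxx.
Qed.

Lemma path_graph_nil2 x : (path_graph x [::]).2 = set0.
Proof. by apply/setP => e; rewrite in_set0; apply/imsetP => -[]. Qed.

Lemma is_path_between_singleton x : is_path_between x x (path_graph x [::]).
Proof.
apply/andP; split.
  rewrite /is_subgraph path_graph_nil2 sub0set.
  by apply/forall_inP => e; rewrite inE.
apply/existsP; exists (Ordinal (vertex_nonnull G)).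
by apply/existsP; exists [tuple]; rewrite /= !eqxx.
Qed.

Lemma is_path_singleton x : is_path (path_graph x [::]).
Proof.
by apply/existsP; exists x; apply/existsP; exists x;
   apply: is_path_between_singleton.
Qed.

Lemma is_induced_path_singleton x : is_induced_path (path_graph x [::]).
Proof.
apply/andP; split; last exact: is_path_singleton.
rewrite /is_induced_subgraph path_graph_nil2 eq_sym; apply/eqP/setP => e.
rewrite !inE; apply/negP => /andP[/imsetP[[y z]]]; rewrite inE /= => yz -> /subsetP s.
have:= s y; have := s z; rewrite !inE !eqxx !orbT => /(_ isT) /eqP zx /(_ isT) /eqP yx.
by rewrite yx zx adj_irr in yz.
Qed.

Lemma is_isometric_path_singleton x : is_isometric_path (path_graph x [::]).
Proof.
apply/existsP; exists x; apply/existsP; exists x.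
rewrite is_path_between_singleton; apply/forallP => H'; apply/implyP => _.
by rewrite /path_length path_graph_nil2 cards0.
Qed.

Definition pp : nat := ex_minn (singleton_partition is_path_singleton).

Definition indpp : nat :=
  ex_minn (singleton_partition is_induced_path_singleton).

Definition ipp : nat :=
  ex_minn (singleton_partition is_isometric_path_singleton).

Definition is_matching (M : {set {set G}}) := (M \subset edges G) && trivIset M.

Definition matching_number : nat :=
  \max_(M : {set {set G}} | is_matching M) #|M|.

End Subgraphs.

(* Main.v *)
Require Import Defs.
From mathcomp Require Import all_boot.

(** The first two inequalities hold because every induced path is a path and
    every isometric path is induced, so that the families of admissible
    partitions shrink.  An isometric path is induced because an edge joining two
    of its non-consecutive vertices would be a shortcut: see
    [geodesic_chordless], whose induction rests on the fact that a tail of a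
    geodesic is a geodesic.

    For the last inequality, take a maximum matching M and partition the vertices
    into the edges of M and the singletons of the uncovered vertices.  The two
    ends of an edge are at distance 1, so an edge is an isometric path, and this
    partition has at most |M| + (|V| - 2|M|) = |V| - |M| members.

    Lengths of isometric paths are compared with those of all paths, while the
    argument compares sizes of walks (sequences satisfying [path adj]); removing
    loops from a walk and counting the edges of a path, [isometric_pathP]
    identifies the two notions. *)

Set Implicit Arguments.
Unset Strict Implicit.
Unset Printing Implicit Defensive.

Section PathPartitions.
Variable G : sgraph.
Implicit Types (x y z : G) (p q : seq G) (H : preSubgraph G) (A : {set G}).

(** * Paths as vertex sequences *)

Lemma mem_edges x y : ([set x; y] \in edges G) = adj x y.
Proof.
apply/imsetP/idP => [[[a b]]|xy]; last by exists (x, y); rewrite ?inE.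
rewrite inE /= => ab E.
have /set2P a_xy: a \in [set x; y] by rewrite E set21.
have /set2P b_xy: b \in [set x; y] by rewrite E set22.
have /set2P[x_a | x_b]: x \in [set a; b] by rewrite -E set21.
  by case: b_xy => eb; rewrite ?x_a -?eb // eb x_a adj_irr in ab *.
by case: a_xy => ea; rewrite ?x_b -?ea 1?adj_sym // ea x_b adj_irr in ab *.
Qed.

Lemma path_graph_cons2 x y p :
  (path_graph x (y :: p)).2 = [set x; y] |: (path_graph y p).2.
Proof.
apply/setP => e; rewrite !inE; apply/imsetP/orP => [[z]|].
  rewrite inE => /predU1P[-> ->|zp ->]; first by left.
  by right; apply/imsetP; exists z; rewrite ?inE.
case=> [/eqP->|/imsetP[z zp ->]]; first by exists (x, y); rewrite ?inE ?eqxx.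
by exists z => //; move: zp; rewrite !inE => ->; rewrite orbT.
Qed.

Lemma path_graph_sub x p e :
  e \in (path_graph x p).2 -> e \subset (path_graph x p).1.
Proof.
elim: p x => [|y p IHp] x; first by rewrite path_graph_nil2 inE.
rewrite path_graph_cons2 => /setU1P[->|/IHp ep]; apply/subsetP => z.
  by rewrite !inE => /orP[]->; rewrite ?orbT.
by move/(subsetP ep); rewrite !inE => ->; rewrite orbT.
Qed.

Lemma path_graph_subgraph x p : is_subgraph (path_graph x p) = path (@adj G) x p.
Proof.
rewrite /is_subgraph; have ->: [forall e in (path_graph x p).2,
    e \subset (path_graph x p).1] by apply/forall_inP => e /path_graph_sub.
rewrite andbT; elim: p x => [|y p IHp] x; first by rewrite path_graph_nil2 sub0set.
by rewrite path_graph_cons2 subUset sub1set mem_edges IHp.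
Qed.

(** The edge joining x to its successor does not recur later in the path, because
    the vertex x does not. *)
Lemma path_length_path_graph x p :
  uniq (x :: p) -> path_length (path_graph x p) = size p.
Proof.
rewrite /path_length; elim: p x => [|y p IHp] x.
  by rewrite path_graph_nil2 cards0.
rewrite cons_uniq => /andP[xp /IHp sz]; rewrite path_graph_cons2 cardsU1 sz.
suff -> : [set x; y] \notin (path_graph y p).2 by rewrite add1n.
apply: contra xp => /path_graph_sub/subsetP/(_ x).
by rewrite set21 => /(_ isT); rewrite inE.
Qed.

Lemma path_betweenP x y H :
  reflect (exists p, [/\ path (@adj G) x p, uniq (x :: p), last x p = y
                       & H = path_graph x p])
          (is_path_between x y H).
Proof.
apply: (iffP andP) => [[sub /existsP[n /existsP[p /and3P[Up /eqP py /eqP HE]]]]|].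
  by exists p; split=> //; rewrite -path_graph_subgraph -HE.
case=> p [px Up py ->]; split; first by rewrite path_graph_subgraph.
have ltpG : size p < #|G|.
  by rewrite -[(size p).+1]/(size (x :: p)) -(card_uniqP Up) max_card.
apply/existsP; exists (Ordinal ltpG); apply/existsP; exists (in_tuple p).
by rewrite Up py !eqxx.
Qed.

(** * Geodesics *)

(** The competitors q may repeat vertices, so that a tail of a geodesic is seen to
    be a geodesic by prepending a vertex to any competitor of the tail. *)
Definition geodesic x p :=
  path (@adj G) x p /\
  forall q, path (@adj G) x q -> last x q = last x p -> size p <= size q.

Lemma geodesic_behead x y p : geodesic x (y :: p) -> geodesic y p.
Proof.
case=> /= /andP[xy yp] pmin; split=> // q yq lastq.
by have := pmin (y :: q); rewrite /= xy; apply.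
Qed.

(** Removing the loops of a geodesic cannot make it shorter. *)
Lemma geodesic_uniq x p : geodesic x p -> uniq (x :: p).
Proof.
case=> xp pmin; have := pmin (shorten x p).
case/shortenP: xp => q xq Uq qp ltpq.
apply: (leq_size_uniq Uq); last exact: ltpq xq erefl.
move=> z.
by rewrite !inE => /predU1P[-> | /qp->]; rewrite ?eqxx ?orbT.
Qed.

(** Minimality among paths extends to all walks, since removing the loops of a
    walk leaves a path with the same ends that is not longer. *)
Lemma isometric_pathP H :
  reflect (exists x p, geodesic x p /\ H = path_graph x p) (is_isometric_path H).
Proof.
apply: (iffP existsP) => [[x /existsP[y /andP[]]]|[x [p [geo ->]]]].
  move=> /path_betweenP[p [xp Up lastp ->]] /forallP Hmin; exists x, p.
  split=> //; split=> // q xq; case/shortenP: xq => q' xq' Uq' qq' lastq.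
  have /(implyP (Hmin _)) : is_path_between x y (path_graph x q').
    by apply/path_betweenP; exists q'; rewrite lastq.
  rewrite !path_length_path_graph // => /leq_trans-> //.
  by apply: uniq_leq_size qq'; case/andP: Uq'.
have Up := geodesic_uniq geo; case: geo => xp pmin.
exists x; apply/existsP; exists (last x p); apply/andP; split.
  by apply/path_betweenP; exists p.
apply/forallP => H'; apply/implyP => /path_betweenP[q [xq Uq lastq ->{H'}]].
by rewrite !path_length_path_graph // pmin.
Qed.

(** An edge from x to a later vertex w bypasses everything before w. *)
Lemma geodesic_neighbor x p w :
  geodesic x p -> w \in p -> adj x w -> exists q, p = w :: q.
Proof.
move=> geo wp xw; case/splitPr: wp geo => p1 p2 [].
rewrite cat_path last_cat => /= /and3P[_ _ wp2] /(_ (w :: p2)) /=.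
rewrite xw wp2 size_cat => /(_ isT erefl).
by rewrite -[X in _ <= X]add0n leq_add2r leqn0 => /nilP->; exists p2.
Qed.

(** By induction on the path: an edge whose ends both avoid the first vertex lies
    within the tail, and an edge at the first vertex goes to the second one. *)
Lemma geodesic_chordless x p u v : geodesic x p ->
  u \in x :: p -> v \in x :: p -> adj u v -> [set u; v] \in (path_graph x p).2.
Proof.
elim: p x => [|y p IHp] x geo.
  by rewrite !inE => /eqP-> /eqP->; rewrite adj_irr.
have first_edge w : w \in y :: p -> adj x w -> w = y.
  by move=> wp /(geodesic_neighbor geo wp)[q []].
rewrite path_graph_cons2 in_cons => /predU1P[->|up].
  rewrite in_cons => /predU1P[->|vp]; first by rewrite adj_irr.
  by move=> /(first_edge _ vp)->; rewrite setU11.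
rewrite in_cons adj_sym => /predU1P[->|vp].
  by move=> /(first_edge _ up)->; rewrite setUC setU11.
by rewrite adj_sym => uv; rewrite setU1r // IHp //; apply: geodesic_behead geo.
Qed.

(** Inducing turns a partition of the vertices into a family of subgraphs with no
    need to orient the edges of a matching. *)
Definition induced_subgraph A : preSubgraph G :=
  (A, [set e in edges G | e \subset A]).

(** This equality is read in both directions: it makes an isometric path induced,
    and it makes the subgraph induced on one vertex, or on the ends of an edge, an
    isometric path. *)
Lemma geodesic_induced x p :
  geodesic x p -> path_graph x p = induced_subgraph [set z in x :: p].
Proof.
move=> geo; congr pair; apply/setP => e; rewrite inE; apply/idP/andP.
  move=> ep; split; last exact: path_graph_sub ep.
  by case: geo; rewrite -path_graph_subgraph => /andP[/subsetP/(_ e ep)].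
case=> /imsetP[[u v]]; rewrite inE /= => uv ->{e}.
by rewrite subUset !sub1set !inE => /andP[up vp]; apply: geodesic_chordless.
Qed.

Lemma isometric_path_induced H : is_isometric_path H -> is_induced_path H.
Proof.
move=> iH; apply/andP; split.
  by case/isometric_pathP: iH => x [p [/geodesic_induced-> ->]]; apply: eqxx.
case/existsP: iH => x /existsP[y /andP[xy _]].
by apply/existsP; exists x; apply/existsP; exists y.
Qed.

Lemma induced_vertex_isometric x : is_isometric_path (induced_subgraph [set x]).
Proof.
have geo : geodesic x [::] by [].
apply/isometric_pathP; exists x, [::]; split=> //.
rewrite (geodesic_induced geo); congr induced_subgraph.
by apply/setP => z; rewrite !inE.
Qed.

Lemma induced_edge_isometric e :
  e \in edges G -> is_isometric_path (induced_subgraph e).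
Proof.
case/imsetP=> [[x y]]; rewrite inE /= => xy ->.
have geo : geodesic x [:: y].
  split=> [|[|//] _ /= yx]; first by rewrite /= xy.
  by rewrite -yx adj_irr in xy.
apply/isometric_pathP; exists x, [:: y]; split=> //.
rewrite (geodesic_induced geo); congr induced_subgraph.
by apply/setP => z; rewrite !inE.
Qed.

(** * Comparing partition numbers *)

(** Stated for the minima themselves, with arbitrary existence proofs, since
    [pp], [indpp] and [ipp] are such minima for three predicates. *)
Lemma leq_partition_number (Q Q' : pred (preSubgraph G))
    (exQ : exists k, partitionable_into Q k)
    (exQ' : exists k, partitionable_into Q' k) :
  (forall H, Q H -> Q' H) -> ex_minn exQ' <= ex_minn exQ.
Proof.
move=> QQ'; case: (ex_minnP exQ) => k /existsP[P /and3P[partP QP cardP]] _.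
case: ex_minnP => k' _; apply; apply/existsP; exists P; rewrite partP cardP andbT.
by apply/forall_inP => H HP; apply/QQ'/(forall_inP QP).
Qed.

Lemma leq_partition_induced (Q : pred (preSubgraph G))
    (exQ : exists k, partitionable_into Q k) (D : {set {set G}}) :
  partition D [set: G] -> {in D, forall A, Q (induced_subgraph A)} ->
  ex_minn exQ <= #|D|.
Proof.
move=> partD QD; have inj : injective induced_subgraph by move=> A B [].
rewrite -(card_imset (mem D) inj); case: ex_minnP => k _; apply.
apply/existsP; exists (induced_subgraph @: D); rewrite eqxx andbT.
apply/andP; split; last by apply/forall_inP => _ /imsetP[A /QD QA ->].
apply/andP; split.
  by apply/dinjectiveP => _ _ /imsetP[A _ ->] /imsetP[B _ ->] /= ->.
by rewrite -imset_comp (eq_imset (g := id)) // imset_id.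
Qed.

(** The matching covers 2|M| vertices, so completing it by the singletons of the
    others gives |M| + (|V| - 2|M|) parts. *)
Lemma completed_partition (M : {set {set G}}) : is_matching M ->
  exists2 D : {set {set G}}, partition D [set: G] &
    {in D, forall A, is_isometric_path (induced_subgraph A)} /\ #|D| + #|M| <= #|G|.
Proof.
case/andP=> /subsetP Medges trivM.
have card_edge e : e \in M -> #|e| = 2.
  move=> /Medges/imsetP[[x y]]; rewrite inE /= => xy ->; rewrite cards2.
  by case: eqP xy => // ->; rewrite adj_irr.
have M0 : set0 \notin M by apply/negP => /card_edge; rewrite cards0.
have partM : partition M (cover M) by rewrite /partition eqxx trivM.
pose S := [set [set x] | x in ~: cover M].
have coverS : cover S = ~: cover M.
  apply/setP => z; apply/bigcupP/idP => [[_ /imsetP[x xM ->]]|zM].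
    by rewrite inE => /eqP->.
  by exists [set z]; rewrite ?inE // imset_f.
exists (M :|: S).
  apply/and3P; split.
  - by rewrite /cover bigcup_setU -/(cover M) -/(cover S) coverS setUCr.
  - apply: trivIsetU => //; last by rewrite coverS disjoints_subset setCK.
    apply/trivIsetP => _ _ /imsetP[x _ ->] /imsetP[y _ ->] xy.
    by rewrite disjoints1 inE; apply: contraNN xy => /eqP->.
  - rewrite inE negb_or M0; apply/imsetP => -[x _ /setP/(_ x)].
    by rewrite !inE eqxx.
split=> [A /setUP[/Medges|/imsetP[x _ ->]]|].
- exact: induced_edge_isometric.
- exact: induced_vertex_isometric.
rewrite -(cardsC (cover M)) (card_uniform_partition card_edge partM).
rewrite muln2 -addnn addnAC leq_add2r cardsU.
by rewrite (leq_trans (leq_subr _ _)) // leq_add2l leq_imset_card.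
Qed.

End PathPartitions.

Theorem proposition1p4 (G : sgraph) :
  pp G <= indpp G /\ indpp G <= ipp G /\ ipp G <= #|G| - matching_number G.
Proof.
split; first by apply: leq_partition_number => H /andP[].
split; first exact/leq_partition_number/isometric_path_induced.
have matching0 : 0 < #|[pred M | @is_matching G M]|.
  apply/card_gt0P; exists set0; rewrite inE /is_matching sub0set.
  by apply/trivIsetP => A B; rewrite inE.
have [M matchM defM] := eq_bigmax_cond (fun M : {set {set G}} => #|M|) matching0.
have [D partD [isoD cardD]] := completed_partition matchM.
rewrite /matching_number [X in _ - X]defM.
apply: leq_trans (leq_partition_induced _ partD isoD) _.
by rewrite -(addnK #|M| #|D|) leq_sub2r.
Qed.
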